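(* There is an absolute constant $C$ such that every finite simple connected $K_4$-free graph $G$ of order $n$ with minimum degree $\delta(G)\ge 5$ satisfies $$\operatorname{diam}(G)\le \frac{5}{11}n+C .$$
   Context: All graphs are finite and simple. $\operatorname{diam}(G)$ is the maximum distance between two vertices of $G$; $K_4$-free means that the clique number satisfies $\omega(G)\le 3$. *)

(* Defs.v *)
From mathcomp Require Import all_boot all_order all_algebra.

Set Implicit Arguments.
Unset Strict Implicit.
Unset Printing Implicit Defensive.

Record sgraph := SGraph {
  vertex :> finType;
  adj : rel vertex;
  adj_sym : symmetric adj;
  adj_irr : irreflexive adj
}.

Section GraphInvariants.
Variable G : sgraph.

Definition degree (x : G) : nat := #|[set y : G | adj x y]|.

(* Every degree is less than #|G|, so on a nonempty graph the default value
   does not affect the minimum; the empty graph gets 0. *)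
Definition min_degree : nat := \big[minn/#|G|]_(x : G) degree x.

Definition clique (K : {set G}) : bool :=
  [forall x in K, forall y in K, (x != y) ==> adj x y].

Definition clique_number : nat := \max_(K : {set G} | clique K) #|K|.

Definition K4_free : Prop := clique_number <= 3.

Definition connected_graph : Prop :=
  0 < #|G| /\ forall x y : G, connect (@adj G) x y.

(* As in path.v, the tuple p omits the starting vertex x, so that its size k is
   the number of edges traversed. *)
Definition walk_of_length (x y : G) (k : nat) : bool :=
  [exists p : k.-tuple G, path (@adj G) x p && (last x p == y)].

(* The least k with a walk of length k from x to y; such a k is below #|G|
   whenever y is reachable from x.  Unreachable pairs get the value #|G|. *)
Definition dist (x y : G) : nat := find (walk_of_length x y) (iota 0 #|G|).

Definition diam : nat := \max_(x : G) \max_(y : G) dist x y.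

End GraphInvariants.

(* Main.v *)
(** Let [a_i] be the sizes of the distance layers from an end of a diametral
    path, and [s_i = a_(i-1) + a_i + a_(i+1)].  A vertex of layer [i] has at
    most [s_i - 6] non-neighbours in the layers [i-1, i, i+1].  The Caro-Wei
    bound, applied to the complement of the graph induced on two consecutive
    layers, where independent sets have at most 3 vertices, therefore gives
    [a_i / (s_i - 5) + a_(i+1) / (s_(i+1) - 5) <= 3].
    These inequalities alone force the average of the [a_i] to be at least
    11/5: a bounded potential on triples of consecutive layer sizes shows it,
    and the periodic sequence 1, 1, 4, 2, 1, 3, 3, 1, 2, 4 attains it. *)
Require Import Defs.
From mathcomp Require Import all_boot all_order all_algebra.
From mathcomp Require Import zify ring lra.

Set Implicit Arguments.
Unset Strict Implicit.
Unset Printing Implicit Defensive.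

Import Order.TTheory GRing.Theory Num.Theory.

(** * The Caro-Wei bound *)

Section CaroWei.
Variables (T : finType) (r : rel T).
Hypothesis r_sym : symmetric r.

Definition neighbors_in (A : {set T}) (x : T) : {set T} := [set y in A | r x y].

(* Greedy choice: removing a vertex of least degree together with its
   neighbours removes a total weight of at most 1. *)
Lemma caro_wei (A : {set T}) :
  exists I : {set T}, [/\ I \subset A,
    {in I &, forall x y, x != y -> ~~ r x y} &
    (\sum_(x in A) (#|neighbors_in A x|.+1%:R : rat)^-1 <= #|I|%:R)%R].
Proof.
have [n] := ubnP #|A|; elim: n A => // n IHn A ltAn.
have [->|[v0 v0A]] := set_0Vmem A.
  by exists set0; rewrite sub0set big_set0; split=> // x y; rewrite inE.
case: (arg_minnP (fun x => #|neighbors_in A x|) v0A) => v vA0 v_min.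
have {vA0}vA : v \in A := vA0.
set N := v |: neighbors_in A v.
have NA : N \subset A by apply/subsetP=> y; rewrite !inE => /predU1P[->|/andP[]].
have vN : v \in N by rewrite setU11.
have ltB : #|A :\: N| < n.
  rewrite -ltnS (leq_trans _ ltAn) // ltnS proper_card // properEneq subsetDl andbT.
  by apply: contraTneq vA => eqA; rewrite -eqA in_setD vN.
have [I [IA indI leI]] := IHn _ ltB.
exists (v |: I); split.
- by rewrite subUset sub1set vA (subset_trans IA) ?subsetDl.
- have vI y : y \in I -> ~~ r v y.
    move/(subsetP IA); rewrite !inE => /andP[/norP[_ yN] yA].
    by move: yN; rewrite yA.
  move=> x y; rewrite !inE => /predU1P[->|xI] /predU1P[->|yI]; first by rewrite eqxx.
  + by move=> _; apply: vI.
  + by move=> _; rewrite r_sym vI.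
  + exact: indI.
- have vnI : v \notin I by apply: contraL vN => /(subsetP IA); rewrite inE => /andP[].
  rewrite cardsU1 vnI natrD (big_setID N) /= (setIidPr NA) lerD //.
    have N_gt0 : 0 < #|N| by rewrite (cardD1 v) vN.
    (* By the choice of [v], each of the [#|N|] vertices of [N] weighs at most [1 / #|N|]. *)
    have leN x : x \in N ->
        ((#|neighbors_in A x|.+1%:R : rat)^-1 <= (#|N|%:R)^-1)%R.
      move=> xN; rewrite lef_pV2 ?posrE ?ltr0n // ler_nat.
      apply: leq_trans (_ : #|neighbors_in A v|.+1 <= _).
        by rewrite cardsU1 -add1n leq_add2r leq_b1.
      by rewrite ltnS; apply/v_min/(subsetP NA).
    apply: le_trans (ler_sum _ leN) _.
    by rewrite sumr_const -[(_ *+ _)%R]mulr_natl mulfV // pnatr_eq0 -lt0n.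
  (* Deleting [N] can only lower the degrees of the other vertices, hence only raise their
     weights. *)
  apply: le_trans leI; apply: ler_sum => x xA.
  rewrite lef_pV2 ?posrE ?ltr0n // ler_nat ltnS subset_leq_card //.
  by apply/subsetP=> y; rewrite !inE => /andP[/andP[_ ->] ->].
Qed.

End CaroWei.

(** * Potential on triples of consecutive layer sizes *)

(* The largest value of [11 * k] minus 5 times the sum of the next [k] terms,
   over [k] and over all sequences continuing [a, b, c] that satisfy the
   hypotheses of [potential_step]; terms from 5 on are not distinguished. *)
Definition potential (a b c : nat) : nat :=
  match c, b with
  | 1, 1 => 0
  | 1, 2 => 2
  | 1, 3 => if a <= 2 then 0 else 4
  | 1, 4 => if a <= 1 then 0 else 6
  | 1, _ => 6
  | 2, 1 => 3
  | 2, 2 => if a <= 2 then 3 else 4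
  | 2, 3 => if a <= 1 then 0 else if a <= 2 then 5 else 8
  | 2, _ => 8
  | 3, 1 | 3, 2 => 6
  | 3, _ => 10
  | 4, 1 => 9
  | _, _ => 12
  end.

Lemma potential_step a b c d :
  0 < a -> 0 < b -> 0 < c -> 0 < d -> 6 <= a + b + c -> 6 <= b + c + d ->
  b * (b + c + d - 5) + c * (a + b + c - 5) <=
    3 * ((a + b + c - 5) * (b + c + d - 5)) ->
  11 + potential b c d <= 5 * d + potential a b c.
Proof.
(* Splitting each size into 1, 2, 3, 4 and at least 5 turns both potentials into numerals. *)
case: a => [|[|[|[|[|a]]]]] //; case: b => [|[|[|[|[|b]]]]] //;
case: c => [|[|[|[|[|c]]]]] //; case: d => [|[|[|[|[|d]]]]] // _ _ _ _;
rewrite /potential ?leqnn /=; lia.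
Qed.

Lemma potential_le12 a b c : potential a b c <= 12.
Proof.
by case: c => [|[|[|[|[|c]]]]] //; case: b => [|[|[|[|[|b]]]]] //=;
   do ?case: ifP.
Qed.

(** Telescopes [potential_step] over the last [k] terms; the first three only set the starting
    potential, and their share of the sum is given away. *)
Lemma potential_sum (a : nat -> nat) k :
  (forall i, i <= k.+2 -> 0 < a i) ->
  (forall i, i < k ->
     let s := a i + a i.+1 + a i.+2 in
     let t := a i.+1 + a i.+2 + a i.+3 in
     [/\ 6 <= s, 6 <= t &
         a i.+1 * (t - 5) + a i.+2 * (s - 5) <= 3 * ((s - 5) * (t - 5))]) ->
  11 * k + potential (a k) (a k.+1) (a k.+2) <=
    5 * \sum_(j < k.+3) a j + potential (a 0) (a 1) (a 2).
Proof.
elim: k => [|k IHk] a_gt0 a_ineq; first by rewrite muln0 leq_addl.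
have [s6 t6 CW] := a_ineq k (ltnSn k).
have step : 11 + potential (a k.+1) (a k.+2) (a k.+3)
    <= 5 * a k.+3 + potential (a k) (a k.+1) (a k.+2).
  by apply: potential_step => //; apply: a_gt0; lia.
have IH := IHk (fun i ik => a_gt0 i (leqW ik)) (fun i ik => a_ineq i (leqW ik)).
rewrite big_ord_recr mulnDr mulnS /=; move: step IH.
move: (potential _ _ _) (potential _ _ _) (potential _ _ _) (\sum_(i < _) _).
lia.
Qed.

(** * Distances and shortest walks *)

Section Distance.
Variable G : sgraph.
Implicit Types x y z : G.

Lemma dist_le_walk x y k : walk_of_length x y k -> dist x y <= k.
Proof.
move=> w; have [ltk|lek] := ltnP k #|G|.
  rewrite leqNgt; apply/negP => /(before_find 0).
  by rewrite nth_iota // w.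
(* For [k >= #|G|] the bound holds because [dist] never exceeds its default value [#|G|]. *)
by apply: leq_trans lek; rewrite -[X in _ <= X](size_iota 0) find_size.
Qed.

Hypothesis G_conn : connected_graph G.

Lemma walk_dist x y : walk_of_length x y (dist x y).
Proof.
have /connectP[p0 p0_path ->] := G_conn.2 x y.
(* A duplicate-free path has fewer than [#|G|] edges, so the search defining [dist] succeeds. *)
case: (shortenP p0_path) => p p_path p_uniq _.
have ltp : size p < #|G| by have := max_card (mem (x :: p)); rewrite (card_uniqP p_uniq).
have hasw : has (walk_of_length x (last x p)) (iota 0 #|G|).
  apply/hasP; exists (size p); first by rewrite mem_iota.
  by apply/existsP; exists (in_tuple p); rewrite /= p_path eqxx.
have := nth_find 0 hasw; rewrite nth_iota // -[X in _ < X](size_iota 0).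
by rewrite -has_find.
Qed.

Lemma dist_adj x y z : adj y z -> dist x z <= (dist x y).+1.
Proof.
move=> yz; apply: dist_le_walk; have /existsP[p /andP[p_path /eqP p_last]] := walk_dist x y.
apply/existsP; exists [tuple of rcons p z].
by rewrite /= rcons_path p_path p_last yz last_rcons eqxx.
Qed.

(** The last vertex but one of a shortest walk from [x] is exactly one step closer to [x]; induction
    on [dist x y - i]. *)
Lemma dist_surj x y i : i <= dist x y -> exists z, dist x z = i.
Proof.
move/subnKC; move: (_ - _) => k; elim: k y => [|k IHk] y dxy.
  by exists y; rewrite -dxy addn0.
have /existsP[[p sz_p] /= /andP[]] := walk_dist x y.
move: sz_p; rewrite -dxy addnS; case/lastP: p => [//|p z].
rewrite size_rcons eqSS rcons_path last_rcons => sz_p /andP[p_path adj_z] /eqP def_z.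
apply: (IHk (last x p)); apply/eqP; rewrite eqn_leq; apply/andP; split.
  by rewrite -ltnS -addnS dxy -def_z dist_adj.
by apply: dist_le_walk; apply/existsP; exists (Tuple sz_p); rewrite /= p_path eqxx.
Qed.

End Distance.

(** * Inequalities between layer sizes *)

Section Layers.
Variables (G : sgraph) (f : G -> nat).
Hypothesis f_adj : forall x y : G, adj x y -> f y <= (f x).+1.
Hypothesis deg_ge5 : forall x : G, 5 <= degree x.
Hypothesis G_K4free : K4_free G.

Definition layer (i : nat) : {set G} := [set x | f x == i].

Definition nonadj (x y : G) : bool := (x != y) && ~~ adj x y.

Lemma nonadj_sym : symmetric nonadj.
Proof. by move=> x y; rewrite /nonadj eq_sym adj_sym. Qed.

(** The closed neighbourhood of [x] has at least 6 vertices, stays within the three layers and is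
    disjoint from the non-neighbours of [x]. *)
Lemma card_window i (A : {set G}) x :
  x \in layer i.+1 -> A \subset layer i :|: layer i.+1 :|: layer i.+2 ->
  6 + #|neighbors_in nonadj A x| <= #|layer i| + #|layer i.+1| + #|layer i.+2|.
Proof.
move=> xL AW; set W := _ :|: _ :|: _ in AW.
(* It suffices to compare with [#|W|]; the union bound on [#|W|] is left for the end. *)
have -> // : forall m, #|W| <= m -> 6 + #|neighbors_in nonadj A x| <= m.
  move=> m; apply: leq_trans.
  set B := x |: [set y | adj x y].
  have cB : 6 <= #|B| by rewrite cardsU1 inE adj_irr ltnS deg_ge5.
  have dB : [disjoint B & neighbors_in nonadj A x].
    rewrite disjoints_subset; apply/subsetP=> y; rewrite !inE /nonadj.
    by case/predU1P=> [->|->]; rewrite ?eqxx !andbF.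
  apply: leq_trans (_ : #|B :|: neighbors_in nonadj A x| <= _).
    by rewrite cardsU (disjoint_setI0 dB) cards0 subn0 leq_add2r.
  apply/subset_leq_card; rewrite !subUset sub1set -andbA.
  apply/and3P; split.
  - by rewrite !inE in xL *; rewrite xL orbT.
  - apply/subsetP=> y; rewrite !inE in xL * => xy.
    have := f_adj xy; rewrite adj_sym in xy; have := f_adj xy.
    by move/eqP: xL => ->; lia.
  - by apply: subset_trans AW; apply/subsetP=> y; rewrite inE => /andP[].
by apply: leq_trans (leq_card_setU _ _) _; rewrite leq_add2r leq_card_setU.
Qed.

(** The set [A] of the two middle layers lies in both windows, so Caro-Wei weights are at least
    [1 / (s - 5)] on one layer and [1 / (t - 5)] on the other. The conclusion clears these
    denominators, positive since [s] and [t] are at least 6. *)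
Lemma layer_ineq i :
  0 < #|layer i.+1| -> 0 < #|layer i.+2| ->
  let s := #|layer i| + #|layer i.+1| + #|layer i.+2| in
  let t := #|layer i.+1| + #|layer i.+2| + #|layer i.+3| in
  [/\ 6 <= s, 6 <= t &
      #|layer i.+1| * (t - 5) + #|layer i.+2| * (s - 5) <= 3 * ((s - 5) * (t - 5))].
Proof.
move=> /card_gt0P[x1 x1L] /card_gt0P[x2 x2L] s t.
set A := layer i.+1 :|: layer i.+2.
have sA : A \subset layer i :|: layer i.+1 :|: layer i.+2 by rewrite -setUA subsetUr.
have tA : A \subset layer i.+1 :|: layer i.+2 :|: layer i.+3 by rewrite subsetUl.
have s6 : 6 <= s := leq_trans (leq_addr _ _) (card_window x1L sA).
have t6 : 6 <= t := leq_trans (leq_addr _ _) (card_window x2L tA).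
split=> //.
have [I [_ I_indep leI]] := caro_wei nonadj_sym A.
have I3 : #|I| <= 3.
  apply: leq_trans G_K4free; apply: (@leq_bigmax_cond _ (@clique G) (fun J => #|J|)).
  apply/forall_inP=> x xI; apply/forall_inP=> y yI; apply/implyP=> xy.
  by have := I_indep x y xI yI xy; rewrite /nonadj xy negbK.
have AE : [disjoint layer i.+1 & layer i.+2].
  rewrite disjoints_subset; apply/subsetP=> y; rewrite !inE => /eqP->.
  by rewrite neq_ltn ltnSn.
have weight_ge (m : nat) (B : {set G}) :
    (forall x, x \in B -> 6 + #|neighbors_in nonadj A x| <= m) ->
    (#|B|%:R / (m - 5)%:R <=
       \sum_(x in B) (#|neighbors_in nonadj A x|.+1%:R : rat)^-1)%R.
  move=> Bm; rewrite mulr_natl -sumr_const; apply: ler_sum => x xB.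
  have := Bm x xB => xm.
  by rewrite lef_pV2 ?posrE ?ltr0n ?ler_nat; lia.
have s0 : (0 < (s - 5)%:R :> rat)%R by rewrite ltr0n; lia.
have t0 : (0 < (t - 5)%:R :> rat)%R by rewrite ltr0n; lia.
have : (#|layer i.+1|%:R / (s - 5)%:R + #|layer i.+2|%:R / (t - 5)%:R <= 3%:R :> rat)%R.
  apply: le_trans (_ : #|I|%:R <= _)%R; last by rewrite ler_nat.
  apply: le_trans leI.
  rewrite (eq_bigl (fun x => x \in [predU layer i.+1 & layer i.+2])); last first.
    by move=> x; rewrite !inE.
  rewrite bigU //=.
  by apply: lerD; apply: weight_ge => x xL; [apply: card_window sA|apply: card_window tA].
rewrite -(ler_nat rat) natrD !natrM => le3.
have := ler_wpM2r (ltW (mulr_gt0 s0 t0)) le3.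
suff -> : ((#|layer i.+1|%:R / (s - 5)%:R + #|layer i.+2|%:R / (t - 5)%:R)
   * ((s - 5)%:R * (t - 5)%:R) = 
   #|layer i.+1|%:R * (t - 5)%:R + #|layer i.+2|%:R * (s - 5)%:R :> rat)%R by [].
by field; rewrite !gt_eqF.
Qed.

Lemma sum_card_layer m : \sum_(j < m) #|layer j| <= #|G|.
Proof.
rewrite -sum1_card (eq_bigr (fun j : 'I_m => \sum_(x : G) (f x == j))).
  rewrite exchange_big; apply: leq_sum => x _ /=.
  have [lt_fx|ge_fx] := ltnP (f x) m.
    rewrite (bigD1 (Ordinal lt_fx)) //= eqxx big1 // => j.
    by rewrite -val_eqE /= eq_sym => /negbTE->.
  by rewrite big1 // => j _; case: eqP => // fxj; move: (ltn_ord j); lia.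
by move=> j _; rewrite -sum1_card big_mkcond; apply: eq_bigr => x _; rewrite inE; case: eqP.
Qed.

Lemma layers_bound D : (forall i, i <= D -> 0 < #|layer i|) -> 11 * D <= 5 * #|G| + 34.
Proof.
case: D => [|[|k]] // layer_gt0; first by lia.
(* Here [D = k + 2], and [34 = 2 * 11 + 12] accounts for the two missing steps and the largest
   starting potential. *)
have := potential_sum layer_gt0 (fun i ik => layer_ineq (layer_gt0 i.+1 (leqW (leqW ik)))
  (layer_gt0 i.+2 (leqW ik))).
have := potential_le12 #|layer 0| #|layer 1| #|layer 2|; have := sum_card_layer k.+3.
lia.
Qed.

End Layers.

(** * From layers to the diameter *)

Lemma degree_ge_min (G : sgraph) (x : G) : min_degree G <= degree x.
Proof. by rewrite /min_degree -minEnat -leEnat; apply: bigmin_le. Qed.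

Lemma dist_bound (G : sgraph) (x y : G) :
  connected_graph G -> K4_free G -> 5 <= min_degree G ->
  11 * dist x y <= 5 * #|G| + 34.
Proof.
move=> G_conn G_K4free deg5; apply: (@layers_bound G (dist x)) => //.
- by move=> u v; apply: dist_adj.
- by move=> u; apply: leq_trans deg5 (degree_ge_min u).
move=> i /(dist_surj G_conn)[z xz]; apply/card_gt0P; exists z.
by rewrite inE xz.
Qed.

Theorem proposition8 :
  exists C : rat, forall G : sgraph,
    connected_graph G -> K4_free G -> 5 <= min_degree G ->
    ((diam G)%:R <= 5 / 11 * #|G|%:R + C)%R.
Proof.
exists (34%:R / 11%:R)%R => G G_conn G_K4free deg5.
have diam_le : 11 * diam G <= 5 * #|G| + 34.
  rewrite mulnC -leq_divRL //; apply/bigmax_leqP => x _; apply/bigmax_leqP => y _.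
  by rewrite leq_divRL // mulnC dist_bound.
move: diam_le; rewrite -(ler_nat rat) natrD !natrM => diam_le; lra.
Qed.
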